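(* Let $\rho:E\to\mathbb{R}$ be a convex quartic form, $\rho(x)=Q[x,x,x,x]$ with $Q:E^4\to\mathbb{R}$ a symmetric $4$-linear form, satisfying $\alpha^2\|x\|^4\le\rho(x)\le\beta^2\|x\|^4$ for all $x\in E$, where $0<\alpha\le\beta$. Then $\rho$ is uniformly convex of degree $4$ with constant $4\alpha^2/3$: for every $x,y\in E$, $$\rho(x)-\rho(y)-\langle\nabla\rho(y),x-y\rangle\ \ge\ \frac{\alpha^2}{3}\|x-y\|^4.$$
   Context: $E$ is a finite-dimensional Euclidean space with canonical pairing $\langle\cdot,\cdot\rangle$, and $\|\cdot\|$ is a Euclidean norm $\|x\|=\langle Bx,x\rangle^{1/2}$ induced by a self-adjoint positive definite operator $B:E\to E^*$. A symmetric $4$-linear form is a map $E^4\to\mathbb{R}$ that is linear in each variable and invariant under permutations of the variables. A differentiable function $g:E\to\mathbb{R}$ is uniformly convex of degree $p\ge 2$ with parameter $\sigma$ if $g(x)-g(y)-\langle\nabla g(y),x-y\rangle\ge\frac{\sigma}{p}\|x-y\|^p$ for all $x,y\in E$. *)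

(* Defs.v *)
From HB Require Import structures.
From mathcomp Require Import all_boot all_order all_algebra all_fingroup.
From mathcomp Require Import all_classical all_reals all_analysis.
Import Order.TTheory GRing.Theory Num.Theory.
Import numFieldNormedType.Exports.

Set Implicit Arguments.
Unset Strict Implicit.
Unset Printing Implicit Defensive.

Local Open Scope classical_set_scope.
Local Open Scope ring_scope.

(* The norm carried by such a space is arbitrary and only supplies the topology
   used by [differentiable] and ['d]; in finite dimension all norms induce the
   same one. Estimates are stated with [euclid_norm] below. *)
#[short(type="normedVectType")]
HB.structure Definition NormedVector (K : numFieldType) :=
  { E of NormedModule K E & Vector K E }.

Section Euclidean.
Variables (R : realType) (E : normedVectType R).

(* For B : E -> E^*, the pairing <B x, y> is the application [B x y]. *)
Definition self_adjoint (B : 'Hom(E, 'Hom(E, R^o))) : Prop :=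
  forall x y : E, B x y = B y x.

Definition positive_definite (B : 'Hom(E, 'Hom(E, R^o))) : Prop :=
  forall x : E, x != 0 -> 0 < (B x x : R).

Definition euclid_norm (B : 'Hom(E, 'Hom(E, R^o))) (x : E) : R :=
  Num.sqrt (B x x : R).

(* [E ^ k] is [{ffun 'I_k -> E}]. *)
Definition multilinear (k : nat) (Q : (E ^ k)%type -> R) : Prop :=
  forall (v : (E ^ k)%type) (i : 'I_k),
    scalar (fun x : E => Q [ffun j => if j == i then x else v j]).

Definition permutation_invariant (k : nat) (Q : (E ^ k)%type -> R) : Prop :=
  forall (s : 'S_k) (v : (E ^ k)%type), Q [ffun j => v (s j)] = Q v.

Definition symmetric_multilinear (k : nat) (Q : (E ^ k)%type -> R) : Prop :=
  multilinear Q /\ permutation_invariant Q.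

(* The gradient lives in E^*: it is the differential. *)
Definition gradient (g : E -> R^o) (y : E) : 'Hom(E, R^o) := linfun ('d g y).

Definition uniformly_convex (nrm : E -> R) (p sigma : R) (g : E -> R^o) : Prop :=
  [/\ 2 <= p,
      forall y : E, differentiable g y
    & forall x y : E,
        sigma / p * (nrm (x - y) `^ p) <= g x - g y - gradient g y (x - y)].

End Euclidean.

(* Main.v *)
Require Import Defs.
From HB Require Import structures.
From mathcomp Require Import all_boot all_order all_algebra all_fingroup.
From mathcomp Require Import all_classical all_reals all_analysis.
From mathcomp Require Import ring lra.
Import Order.TTheory GRing.Theory Num.Theory.
Import numFieldNormedType.Exports.

Set Implicit Arguments.
Unset Strict Implicit.
Unset Printing Implicit Defensive.

Local Open Scope classical_set_scope.
Local Open Scope ring_scope.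

(* Write e = Q[h,h,h,h], d = Q[y,h,h,h] and c = Q[y,y,h,h] with h = x - y, so
   that the left-hand side of the inequality is 6 c + 4 d + e. Convexity of rho
   means Q[z,z,h,h] >= 0 for all z; at z = y + h/3 this reads
   c + 2 d / 3 + e / 9 >= 0, and six times it leaves
   6 c + 4 d + e >= e / 3 >= alpha ^ 2 ||h|| ^ 4 / 3.
   Differentiability of rho for the given norm rests on the continuity of the
   coordinate forms, i.e. on the equivalence of norms in finite dimension. *)

Section FiniteDimension.
Variables (R : realType) (E : normedVectType R).

(** The map [S] from coordinate rows to E is continuous and injective, so [|S u|] attains a positive
    minimum m on the compact unit sphere of rows. By homogeneity m |u| <= |S u| for all u, and 1/m
    serves as the bound. *)
Lemma coord_vbasis_bounded :
  exists2 C : R, 0 < C &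
    forall (i : 'I_(\dim {:E})) (x : E), `|coord (vbasis {:E}) i x| <= C * `|x|.
Proof.
pose b := vbasis {:E}.
pose S (u : 'rV[R]_(\dim {:E})) : E := \sum_i u 0 i *: b`_i.
have S_cont : continuous S.
  apply: (continuous_big (op := +%R)) => [|i _ u]; first exact: add_continuous.
  apply: (@cvgZr_tmp _ _ _ (nbhs u)); exact: coord_continuous.
have SZ k u : S (k *: u) = k *: S u.
  by rewrite /S scaler_sumr; apply: eq_bigr => i _; rewrite mxE scalerA.
have S_inj u : S u = 0 -> u = 0.
  move=> Su0; apply/rowP => i; rewrite mxE.
  have bfree : free b by apply: basis_free (vbasisP _).
  by rewrite -(coord_sum_free (fun i => u 0 i) i bfree) -/(S u) Su0 linear0.
pose sphere := [set u : 'rV[R]_(\dim {:E}) | `|u| = 1].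
have sphere_compact : compact sphere.
  apply: bounded_closed_compact.
    by exists 1; split=> // M M1 u /= ->; exact: ltW.
  rewrite (_ : sphere = Num.norm @^-1` [set 1])//.
  by apply: closed_comp; [move=> *; exact: norm_continuous|exact: closed_eq].
have [m m_gt0 mS] : exists2 m : R, 0 < m & forall u, m * `|u| <= `|S u|.
  have normalize u : u != 0 -> sphere (`|u|^-1 *: u).
    move=> u0; rewrite /sphere /= normrZ ger0_norm ?invr_ge0//.
    by rewrite mulVf// normr_eq0.
  (* In dimension 0 the sphere is empty and has no minimizer; every row is then zero, and m = 1
     works. *)
  have [sphere0|/nonemptyPn sphere0] := pselect (sphere !=set0); last first.
    exists 1 => // u; have [->|u0] := eqVneq u 0; first by rewrite normr0 mulr0.
    by have := normalize _ u0; rewrite sphere0.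
  have [|c c1 minc] := @EVT_min_rV _ _ (fun u => `|S u|) _ sphere0 sphere_compact.
    apply: continuous_subspaceT => u; apply: continuous_comp (S_cont u) _.
    exact: norm_continuous.
  exists `|S c|.
    rewrite normr_gt0; apply/eqP => /S_inj c0; move: c1; rewrite inE /sphere /=.
    by rewrite c0 normr0 => /esym/eqP; rewrite oner_eq0.
  move=> u; have [->|u0] := eqVneq u 0; first by rewrite normr0 mulr0.
  have := minc _ (mem_set (normalize _ u0)).
  rewrite SZ normrZ ger0_norm ?invr_ge0// mulrC ler_pdivlMr//.
  by rewrite normr_gt0.
exists m^-1; first by rewrite invr_gt0.
move=> i x; pose u := \row_j coord b j x.
have Su : S u = x.
  rewrite [RHS](coord_vbasis (memvf x)); apply: eq_bigr => j _.
  by rewrite mxE.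
rewrite ler_pdivlMl//; have := mS u; rewrite Su; apply: le_trans.
(* The norm on rows is the largest absolute value of an entry, so it dominates each coordinate. *)
rewrite ler_pM2l// [leRHS]/Num.Def.normr /= mx_normrE.
by apply/bigmax_geP; right; exists (0, i) => //=; rewrite mxE.
Qed.

Lemma linear_continuous_normedVect (f : {linear E -> R^o}) : continuous f.
Proof.
have [C C_gt0 leC] := coord_vbasis_bounded.
apply: bounded_linear_continuous; apply/bounded_funP => r.
exists (\sum_(i < \dim {:E}) (C * r) * `|f (vbasis {:E})`_i|) => x xr.
rewrite [in f x](coord_vbasis (memvf x)) linear_sum.
apply: le_trans (ler_norm_sum _ _ _) _; apply: ler_sum => i _.
rewrite linearZ normrM ler_wpM2r//; apply: le_trans (leC _ _) _.
by rewrite ler_pM2l.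
Qed.

Lemma scalar_differentiable (f : E -> R^o) y : scalar f -> differentiable f y.
Proof.
move=> fl; pose fL : {linear E -> R^o} :=
  HB.pack f (GRing.isLinear.Build _ _ _ _ f fl).
rewrite (_ : f = fL)//; apply: linear_differentiable.
exact: linear_continuous_normedVect.
Qed.

(** Expanding only the first argument in a basis turns f x x into a finite sum of products of a
    coordinate form with some [f b_i]. Applied repeatedly, this peels the arguments off a
    multilinear form one at a time. *)
Lemma differentiable_diagonal (f : E -> E -> R^o) y :
  (forall x, scalar (f^~ x)) -> (forall a, differentiable (f a) y) ->
  differentiable (fun x => f x x) y.
Proof.
move=> fl fd; set b := vbasis {:E}.
rewrite (_ : (fun x => f x x) =
  \sum_i ((coord b i : E -> R^o) * f b`_i)); last first.
  apply/funext => x.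
  pose fL : {linear E -> R^o} :=
    HB.pack (f^~ x) (GRing.isLinear.Build _ _ _ _ _ (fl x)).
  rewrite -[LHS]/(fL x) [in LHS](coord_vbasis (memvf x)) linear_sum fct_sumE.
  by apply: eq_bigr => i _; rewrite linearZ.
apply: differentiable_sum => i; apply: differentiableM => //.
exact/scalar_differentiable/coord_is_scalar.
Qed.

End FiniteDimension.

Lemma convex_function_midpoint (R : realType) (E : lmodType R) (f : E -> R^o) :
  convex_function setT f -> forall x h, 2 * f x <= f (h + x) + f (- h + x).
Proof.
move=> fc x h; have half_ge0 : 0 <= 2^-1 :> R by lra.
have half_le1 : 2^-1 <= 1 :> R by lra.
have : f (2^-1 *: (h + x) + (1 - 2^-1) *: (- h + x))
    <= 2^-1 * f (h + x) + (1 - 2^-1) * f (- h + x).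
  exact: fc (Itv01 half_ge0 half_le1) _ _ (in_setT _) (in_setT _).
have -> : 1 - 2^-1 = 2^-1 :> R by lra.
rewrite -scalerDr addrACA subrr add0r -mulr2n -(scaler_nat _ x) scalerA.
rewrite mulVf ?pnatr_eq0// scale1r; lra.
Qed.

Section QuarticForm.
Variables (R : realType) (E : normedVectType R) (Q : (E ^ 4)%type -> R).
Hypothesis Q_sym : symmetric_multilinear Q.

Definition quad (a b c d : E) : R^o :=
  Q [ffun i => nth 0 [:: a; b; c; d] (val i)].

Lemma quad_diag x : quad x x x x = Q [ffun=> x].
Proof.
by congr Q; apply/ffunP => -[[|[|[|[|]]]] ?] //; rewrite !ffunE.
Qed.

(** Adjacent transpositions are enough for the sequel: they carry linearity from the first slot to
    the others and sort mixed terms. *)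
Lemma quad_perm (i j : 'I_4) (v : seq E) :
  Q [ffun k => nth 0 v (val (tperm i j k))] = Q [ffun k => nth 0 v (val k)].
Proof.
have [_ Qp] := Q_sym.
rewrite -[RHS](Qp (tperm i j)); congr Q; apply/ffunP => k.
by rewrite !ffunE.
Qed.

Lemma quadC12 a b c d : quad a b c d = quad b a c d.
Proof.
rewrite /quad -(quad_perm 0 1); congr Q; apply/ffunP => i.
by rewrite !ffunE permE /=; case: i => [[|[|[|[|]]]]].
Qed.

Lemma quadC23 a b c d : quad a b c d = quad a c b d.
Proof.
rewrite /quad -(quad_perm 1 2); congr Q; apply/ffunP => i.
by rewrite !ffunE permE /=; case: i => [[|[|[|[|]]]]].
Qed.

Lemma quadC34 a b c d : quad a b c d = quad a b d c.
Proof.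
rewrite /quad -(quad_perm 2 3); congr Q; apply/ffunP => i.
by rewrite !ffunE permE /=; case: i => [[|[|[|[|]]]]].
Qed.

Lemma quad_linear1 b c d : scalar (fun x => quad x b c d).
Proof.
have [Ql _] := Q_sym => k x y.
have := Ql [ffun i => nth 0 [:: x; b; c; d] (val i)] 0 k x y.
have F z : [ffun j : 'I_4 => if j == 0 then z else
      [ffun i : 'I_4 => nth 0 [:: x; b; c; d] (val i)] j]
    = [ffun i => nth 0 [:: z; b; c; d] (val i)] :> (E ^ 4)%type.
  by apply/ffunP => -[[|[|[|[|]]]] ?] //; rewrite !ffunE.
by rewrite /= !F.
Qed.

Lemma quad_linear2 a c d : scalar (fun x => quad a x c d).
Proof. by move=> k x y; rewrite !(quadC12 a) quad_linear1. Qed.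

Lemma quad_linear3 a b d : scalar (fun x => quad a b x d).
Proof. by move=> k x y; rewrite !(quadC23 _ b) quad_linear2. Qed.

Lemma quad_linear4 a b c : scalar (fun x => quad a b c x).
Proof. by move=> k x y; rewrite !(quadC34 _ _ c) quad_linear3. Qed.

Definition quad_linear :=
  (quad_linear1, quad_linear2, quad_linear3, quad_linear4).

Lemma quad_expand y h t : let z := t *: h + y in
  quad z z z z = quad y y y y + 4 * quad y y y h * t + 6 * quad y y h h * t ^+ 2
                 + 4 * quad y h h h * t ^+ 3 + quad h h h h * t ^+ 4.
Proof.
move=> z; rewrite /z !quad_linear.
(* A bubble sort moves every y before every h in the 16 terms of the expansion, after which like
   terms can be collected. *)
rewrite !(quadC12 h y) !(quadC23 _ h y) !(quadC34 _ _ h y).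
rewrite !(quadC12 h y) !(quadC23 _ h y) !(quadC12 h y).
ring.
Qed.

Lemma quad_expand2 y h t : let z := t *: h + y in
  quad z z h h = quad y y h h + 2 * quad y h h h * t + quad h h h h * t ^+ 2.
Proof.
move=> z; rewrite /z !quad_linear (quadC12 h y).
ring.
Qed.

Lemma quad_differentiable y : differentiable (fun x => quad x x x x) y.
Proof.
apply: (@differentiable_diagonal _ _ (fun u x => quad u x x x)) => [x|a].
  exact: quad_linear1.
apply: (@differentiable_diagonal _ _ (fun u x => quad a u x x)) => [x|b].
  exact: quad_linear2.
apply: (@differentiable_diagonal _ _ (fun u x => quad a b u x)) => [x|c].
  exact: quad_linear3.
exact/scalar_differentiable/quad_linear4.
Qed.

Lemma quad_diff y h : 'd (fun x => quad x x x x) y h = 4 * quad y y y h.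
Proof.
rewrite -deriveE; last exact: quad_differentiable.
(* By [quad_expand], [p] evaluated at t != 0 is the difference quotient along h; the derivative is
   its constant coefficient. *)
pose p : {poly R} := Poly [:: 4 * quad y y y h; 6 * quad y y h h;
  4 * quad y h h h; quad h h h h].
have p_cvg : p.[t] @[t --> 0^'] --> 4 * quad y y y h.
  rewrite -[X in _ --> X](_ : p.[0] = _); last by rewrite horner_Poly /= mulr0 add0r.
  by apply: cvg_within_filter; exact: continuous_horner.
rewrite /derive; apply: cvg_lim => //.
apply: cvg_trans p_cvg; apply: near_eq_cvg.
near=> t => /=.
have t0 : t != 0 by near: t; exact: nbhs_dnbhs_neq.
rewrite horner_Poly quad_expand /GRing.scale /=.
by field.
Unshelve. all: by end_near. Qed.

(** In the symmetric second difference of the form at z along s h the odd powers of s cancel, so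
    convexity gives 6 c + s^2 e >= 0 for every s > 0. A small explicit s, in place of a limit, rules
    out c < 0. *)
Lemma quad_hessian_ge0 z h : convex_function setT (fun x => quad x x x x) ->
  0 <= quad h h h h -> 0 <= quad z z h h.
Proof.
move=> /convex_function_midpoint q_convex; set e := quad h h h h.
set c := quad z z h h; move=> e_ge0; rewrite leNgt; apply/negP => c_lt0.
have second_difference s : 0 < s -> 0 <= 6 * c + s ^+ 2 * e.
  move=> s_gt0; rewrite -(pmulr_rge0 _ (exprn_gt0 2 s_gt0)).
  have := q_convex z (s *: h); rewrite -scaleNr !quad_expand -/c -/e => le2.
  set a := quad z z z z in le2; set b := quad z z z h in le2.
  set d := quad z h h h in le2.
  rewrite [leRHS](_ : _ = 2^-1 * ((a + 4 * b * s + 6 * c * s ^+ 2 +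
      4 * d * s ^+ 3 + e * s ^+ 4 + (a + 4 * b * - s + 6 * c * (- s) ^+ 2 +
      4 * d * (- s) ^+ 3 + e * (- s) ^+ 4)) - 2 * a)); last by field.
  by rewrite mulr_ge0 ?invr_ge0// subr_ge0.
(* Any s with 0 < s <= 1 and s e <= - c contradicts [second_difference]. *)
have ce_lt0 : c - e < 0 by lra.
pose s := c / (c - e).
have sE : s * e = s * c - c by rewrite /s; field; rewrite lt_eqF.
have s_gt0 : 0 < s by rewrite nmulr_lgt0// invr_lt0.
have s_le1 : s <= 1 by rewrite ler_ndivrMr// mul1r; lra.
have := second_difference _ s_gt0; rewrite expr2 -mulrA sE.
(* Here s^2 e = s^2 c - s c <= - c, so 6 c + s^2 e <= 5 c < 0. *)
have : s * s * c <= 0 by nra.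
have : s * - c <= 1 * - c by rewrite ler_wpM2r//; lra.
lra.
Qed.

Lemma quad_bregman_ge y h : convex_function setT (fun x => quad x x x x) ->
  (forall x, 0 <= quad x x x x) ->
  3^-1 * quad h h h h <=
    quad (h + y) (h + y) (h + y) (h + y) - quad y y y y - 4 * quad y y y h.
Proof.
move=> q_convex q_ge0.
have := quad_expand y h 1; rewrite /= scale1r => ->.
(* The weight t = 1/3 solves 6 * 2 t = 4, which makes the terms in [quad y h h h] cancel. *)
have := quad_hessian_ge0 (3^-1 *: h + y) q_convex (q_ge0 h).
rewrite quad_expand2; lra.
Qed.

End QuarticForm.

Theorem proposition3p3 (R : realType) (E : normedVectType R)
    (B : 'Hom(E, 'Hom(E, R^o)))
    (B_adj : self_adjoint B) (B_pos : positive_definite B)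
    (Q : (E ^ 4)%type -> R) (Q_sym : symmetric_multilinear Q)
    (rho : E -> R^o) (rhoE : forall x : E, rho x = Q [ffun=> x])
    (rho_convex : convex_function setT rho)
    (alpha beta : R) (alpha_gt0 : 0 < alpha) (le_alpha_beta : alpha <= beta)
    (rho_lower : forall x : E, alpha ^+ 2 * euclid_norm B x ^+ 4 <= rho x)
    (rho_upper : forall x : E, rho x <= beta ^+ 2 * euclid_norm B x ^+ 4) :
  uniformly_convex (euclid_norm B) 4 (4 * alpha ^+ 2 / 3) rho /\
  (forall x y : E,
     alpha ^+ 2 / 3 * euclid_norm B (x - y) ^+ 4
       <= rho x - rho y - gradient rho y (x - y)).
Proof.
have rho_quad : rho = fun x => quad Q x x x x.
  by apply/funext => x; rewrite rhoE quad_diag.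
have rho_diff y : differentiable rho y.
  by rewrite rho_quad; exact: quad_differentiable.
have rho_ge0 h : 0 <= rho h.
  by apply: le_trans (rho_lower h); rewrite mulr_ge0 ?exprn_ge0 ?sqrtr_ge0// ltW.
have bregman x y : alpha ^+ 2 / 3 * euclid_norm B (x - y) ^+ 4
    <= rho x - rho y - gradient rho y (x - y).
  apply: le_trans (_ : 3^-1 * rho (x - y) <= _).
    have := rho_lower (x - y); lra.
  rewrite /gradient lfunE rho_quad /= quad_diff//.
  have := quad_bregman_ge Q_sym y (x - y).
  rewrite subrK; apply; first by rewrite -rho_quad.
  by move=> h; rewrite quad_diag -rhoE.
split=> //; split=> // [|x y]; first by rewrite ler_nat.
(* With sigma / p simplified, only the real power 4 differs from [bregman]; it agrees with the
   natural power because the norm is nonnegative. *)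
have -> : 4 * alpha ^+ 2 / 3 / 4 = alpha ^+ 2 / 3 by field.
by rewrite powR_mulrn ?sqrtr_ge0.
Qed.
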